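(* Let $E_{24}$ be the elliptic curve over the function field $\mathbb{Q}(a)$ given by $y^2 = x^3 + (4a-1)x^2 + 16a\,x + 64a^2 - 16a$. Then $E_{24}(\mathbb{Q}(a))$ has rank $0$ and torsion subgroup isomorphic to $\mathbb{Z}/4\mathbb{Z}$, generated by the point $(x,y) = (2, 8a+2)$.
   Context: $E_{24}$ is a Weierstrass model of the genus-one curve $V(s^2 - tz - (t^2-az^2),\, u^2 + tz - (t^2-az^2)) \subset \mathbb{P}^3_{\mathbb{Q}(a)}$ with coordinates $(s,t,u,z)$; its $j$-invariant is $(16a^2-56a+1)^3/(a(4a+1)^4)$ and discriminant $a(4a+1)^4$. *)

(* Defs.v *)
From HB Require Import structures.
From mathcomp Require Import all_boot all_order all_algebra.
From mathcomp Require Import ring.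

Set Implicit Arguments.
Unset Strict Implicit.
Unset Printing Implicit Defensive.

Import GRing.Theory.
Local Open Scope ring_scope.

(* Curves are given as y^2 = x^3 + a2 x^2 + a4 x + a6.  The discriminant is 16
   times that of the cubic; it vanishes identically in characteristic 2, so the
   smoothness condition below excludes that characteristic. *)
Definition weierstrass_disc (K : fieldType) (a2 a4 a6 : K) : K :=
  16 * (a2 ^+ 2 * a4 ^+ 2 - 4 * a4 ^+ 3 - 4 * a2 ^+ 3 * a6
        + 18 * a2 * a4 * a6 - 27 * a6 ^+ 2).

Record ellcurve (K : fieldType) := EllCurve {
  ec_a2 : K;
  ec_a4 : K;
  ec_a6 : K;
  ec_smooth : weierstrass_disc ec_a2 ec_a4 ec_a6 != 0
}.

Section RawGroupLaw.
Variables (K : fieldType) (E : ellcurve K).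
Local Notation a2 := (ec_a2 E).
Local Notation a4 := (ec_a4 E).
Local Notation a6 := (ec_a6 E).

(* None is the point at infinity. *)
Definition ec_on (p : option (K * K)) : bool :=
  if p is Some (x, y) then y ^+ 2 == x ^+ 3 + a2 * x ^+ 2 + a4 * x + a6
  else true.

Definition ec_neg (p : option (K * K)) : option (K * K) :=
  if p is Some (x, y) then Some (x, - y) else None.

Definition ec_slope (x1 y1 x2 y2 : K) : K :=
  if x1 == x2 then (3 * x1 ^+ 2 + 2 * a2 * x1 + a4) / (2 * y1)
  else (y2 - y1) / (x2 - x1).

Definition ec_add (p q : option (K * K)) : option (K * K) :=
  match p, q with
  | None, _ => q
  | _, None => p
  | Some (x1, y1), Some (x2, y2) =>
    if (x1 == x2) && (y1 == - y2) then None
    else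
      let l := ec_slope x1 y1 x2 y2 in
      let x3 := l ^+ 2 - a2 - x1 - x2 in
      Some (x3, l * (x1 - x3) - y1)
  end.

Lemma ec_smoothP x y :
  y ^+ 2 = x ^+ 3 + a2 * x ^+ 2 + a4 * x + a6 ->
  y = 0 -> 3 * x ^+ 2 + 2 * a2 * x + a4 = 0 -> False.
Proof.
move=> cxy y0 dx; move: (ec_smooth E) => /negP; apply; apply/eqP.
have e4 : a4 = - (3 * x ^+ 2 + 2 * a2 * x).
  by apply/eqP; rewrite -addr_eq0 addrC dx.
have e6 : a6 = - (x ^+ 3 + a2 * x ^+ 2 + a4 * x).
  apply/eqP; rewrite -addr_eq0 addrC -cxy y0; apply/eqP; ring.
by rewrite /weierstrass_disc e6 e4; ring.
Qed.

Lemma ec_two_neq0 : 2 != 0 :> K.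
Proof.
apply/negP => /eqP h; move: (ec_smooth E) => /negP; apply; apply/eqP.
rewrite /weierstrass_disc.
have -> : 16 = 2 * 8 :> K by ring.
by rewrite h !mul0r.
Qed.

(* The cubic minus (l x + m)^2 is the product of the x - x_i, so the line
   y = l x + m meets the curve in the three given points, with multiplicity. *)
Definition ec_line (x1 y1 x2 y2 x3 y3 l m : K) : Prop :=
  [/\ y1 = l * x1 + m, y2 = l * x2 + m & y3 = l * x3 + m] /\
  [/\ a2 = l ^+ 2 - (x1 + x2 + x3),
      a4 = 2 * l * m + (x1 * x2 + x1 * x3 + x2 * x3) &
      a6 = m ^+ 2 - x1 * x2 * x3].

Lemma ec_line_rot x1 y1 x2 y2 x3 y3 l m :
  ec_line x1 y1 x2 y2 x3 y3 l m -> ec_line x2 y2 x3 y3 x1 y1 l m.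
Proof.
rewrite /ec_line /ec_on; case=> [[? ? ?] [-> -> ->]]; split; split=> //; ring.
Qed.

Lemma ec_line_swap x1 y1 x2 y2 x3 y3 l m :
  ec_line x1 y1 x2 y2 x3 y3 l m -> ec_line x2 y2 x1 y1 x3 y3 l m.
Proof.
rewrite /ec_line /ec_on; case=> [[? ? ?] [-> -> ->]]; split; split=> //; ring.
Qed.

Lemma ec_line_neg x1 y1 x2 y2 x3 y3 l m :
  ec_line x1 y1 x2 y2 x3 y3 l m ->
  ec_line x1 (- y1) x2 (- y2) x3 (- y3) (- l) (- m).
Proof.
rewrite /ec_line /ec_on; case=> [[-> -> ->] [-> -> ->]]; split; split; ring.
Qed.

Lemma ec_line_on x1 y1 x2 y2 x3 y3 l m :
  ec_line x1 y1 x2 y2 x3 y3 l m -> ec_on (Some (x1, y1)).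
Proof.
rewrite /ec_line /ec_on; case=> [[-> _ _] [-> -> ->]]; apply/eqP; ring.
Qed.

Lemma ec_same_x x1 y1 x2 y2 :
  ec_on (Some (x1, y1)) -> ec_on (Some (x2, y2)) -> x1 = x2 ->
  y1 = y2 \/ y1 = - y2.
Proof.
move=> /= /eqP c1 /eqP c2 e; have: y1 ^+ 2 == y2 ^+ 2 by rewrite c1 c2 e.
by rewrite eqf_sqr => /orP [] /eqP; [left | right].
Qed.

Lemma ec_addP x1 y1 x2 y2 :
  ec_on (Some (x1, y1)) -> ec_on (Some (x2, y2)) ->
  ~~ ((x1 == x2) && (y1 == - y2)) ->
  exists x3 y3 l m, ec_line x1 y1 x2 y2 x3 (- y3) l m /\
    ec_add (Some (x1, y1)) (Some (x2, y2)) = Some (x3, y3).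
Proof.
move=> c1 c2 nop; rewrite /ec_add (negbTE nop).
set l := ec_slope _ _ _ _; set x3 := l ^+ 2 - _ - _ - _.
exists x3, (l * (x1 - x3) - y1), l, (y1 - l * x1); split=> //.
have two := ec_two_neq0.
have [e|ne] := eqVneq x1 x2.
  have ey : y1 = y2.
    case: (ec_same_x c1 c2 e) => // h.
    by move: nop; rewrite e h !eqxx.
  have y0 : y1 != 0.
    apply/eqP => y0; move: nop; rewrite e eqxx -ey y0 oppr0 eqxx //.
  have el : 2 * l * y1 = 3 * x1 ^+ 2 + 2 * a2 * x1 + a4.
    rewrite /l /ec_slope e eqxx; field; rewrite two y0 //.
  move: c1 => /eqP c1.
  have e4 : a4 = 2 * l * y1 - (3 * x1 ^+ 2 + 2 * a2 * x1) by rewrite el; ring.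
  have e6 : a6 = y1 ^+ 2 - (x1 ^+ 3 + a2 * x1 ^+ 2 + a4 * x1).
    by rewrite c1; ring.
  split; split; rewrite -?ey -?e; try (rewrite /x3 -?e; ring).
  - by rewrite e4 /x3 -e; ring.
  - by rewrite e6 e4 /x3 -e; ring.
have d0 : x2 - x1 != 0 by rewrite subr_eq0 eq_sym.
have el : y2 = y1 + l * (x2 - x1).
  by rewrite /l /ec_slope (negbTE ne); field.
move: c1 c2 => /eqP c1 /eqP c2.
have e4 : a4 = l * (y1 + y2) - (x1 ^+ 2 + x1 * x2 + x2 ^+ 2 + a2 * (x1 + x2)).
  apply: (mulfI d0).
  have -> : (x2 - x1) * a4 = y2 ^+ 2 - y1 ^+ 2 - (x2 ^+ 3 - x1 ^+ 3)
    - a2 * (x2 ^+ 2 - x1 ^+ 2).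
    by rewrite c1 c2; ring.
  by rewrite el; ring.
have e6 : a6 = y1 ^+ 2 - (x1 ^+ 3 + a2 * x1 ^+ 2 + a4 * x1) by rewrite c1; ring.
split; split; try (rewrite /x3 ?el; ring).
- by rewrite e4 /x3 el; ring.
- by rewrite e6 e4 /x3 el; ring.
Qed.

Lemma ec_line_nopp x1 y1 x2 y2 x3 y3 l m :
  ec_line x1 y1 x2 y2 x3 y3 l m -> ~~ ((x1 == x2) && (y1 == - y2)).
Proof.
move=> L; have /eqP c1 := ec_line_on L; case: L => [[e1 e2 e3] [h2 h4 h6]].
apply/negP => /andP [/eqP ex /eqP ey].
have y0 : y1 = 0.
  apply: (mulfI ec_two_neq0); rewrite mulr0.
  have -> : 2 * y1 = y1 - - y1 by ring.
  by rewrite {1}ey e2 e1 ex; ring.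
apply: (ec_smoothP c1 y0).
have -> : 3 * x1 ^+ 2 + 2 * a2 * x1 + a4 = 2 * l * y1.
  by rewrite h4 h2 e1 ex; ring.
by rewrite y0 mulr0.
Qed.

Lemma ec_line_add x1 y1 x2 y2 x3 y3 l m :
  ec_line x1 y1 x2 y2 x3 y3 l m ->
  ec_add (Some (x1, y1)) (Some (x2, y2)) = Some (x3, - y3).
Proof.
move=> L; have nop := ec_line_nopp L; rewrite /ec_add (negbTE nop).
have el : ec_slope x1 y1 x2 y2 = l.
  rewrite /ec_slope; case: L => [[e1 e2 e3] [h2 h4 h6]].
  have [e|ne] := eqVneq x1 x2.
    have y0 : y1 != 0.
      apply/eqP => y0; move: nop.
      by rewrite e eqxx /= e2 -e -e1 y0 oppr0 eqxx.
    have -> : 3 * x1 ^+ 2 + 2 * a2 * x1 + a4 = 2 * l * y1.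
      by rewrite h4 h2 e1 -e; ring.
    by field; rewrite ec_two_neq0 y0.
  have d0 : x2 - x1 != 0 by rewrite subr_eq0 eq_sym.
  by rewrite e1 e2; field.
rewrite el; case: L => [[-> e2 ->] [h2 h4 h6]] /=.
have -> : l ^+ 2 - a2 - x1 - x2 = x3 by rewrite h2; ring.
by congr (Some (_, _)); ring.
Qed.

Lemma ec_neg_on p : ec_on p -> ec_on (ec_neg p).
Proof. by case: p => [[x y]|] //=; rewrite sqrrN. Qed.

Lemma ec_negK p : ec_neg (ec_neg p) = p.
Proof. by case: p => [[x y]|] //=; rewrite opprK. Qed.

Lemma ec_add_on p q : ec_on p -> ec_on q -> ec_on (ec_add p q).
Proof.
case: p q => [[x1 y1]|] [[x2 y2]|] // c1 c2.
have [nop|nop] := boolP ((x1 == x2) && (y1 == - y2)).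
  by rewrite /ec_add nop.
have [x3 [y3 [l [m [L ->]]]]] := ec_addP c1 c2 nop.
have := ec_line_on (ec_line_rot (ec_line_rot L)).
by rewrite /= sqrrN.
Qed.

Lemma ec_add0 p : ec_add p None = p.
Proof. by case: p => [[x y]|]. Qed.

Lemma ec_addN p : ec_add (ec_neg p) p = None.
Proof. by case: p => [[x y]|] //=; rewrite !eqxx. Qed.

Lemma ec_addC p q : ec_on p -> ec_on q -> ec_add p q = ec_add q p.
Proof.
case: p q => [[x1 y1]|] [[x2 y2]|] // c1 c2.
have [nop|nop] := boolP ((x1 == x2) && (y1 == - y2)).
  rewrite /ec_add nop; move: nop => /andP [/eqP -> /eqP ->].
  by rewrite opprK !eqxx.
have [x3 [y3 [l [m [L ->]]]]] := ec_addP c1 c2 nop.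
by rewrite (ec_line_add (ec_line_swap L)) opprK.
Qed.

Lemma ec_neg_eq0 p q : ec_add p q = None -> q = ec_neg p.
Proof.
case: p q => [[x1 y1]|] [[x2 y2]|] //=.
by case: ifP => // /andP [/eqP -> /eqP ->]; rewrite opprK.
Qed.

Lemma ec_addK p q :
  ec_on p -> ec_on q -> ec_add (ec_add p q) (ec_neg q) = p.
Proof.
case: p q => [[x1 y1]|] [[x2 y2]|] // c1 c2.
  have [nop|nop] := boolP ((x1 == x2) && (y1 == - y2)).
    rewrite /ec_add nop; move: nop => /andP [/eqP -> /eqP ->] //.
  have [x3 [y3 [l [m [L ->]]]]] := ec_addP c1 c2 nop.
  have L' := ec_line_neg (ec_line_swap (ec_line_rot L)).
  by move: L'; rewrite opprK => /ec_line_add ->; rewrite opprK.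
by rewrite /ec_add /ec_neg opprK !eqxx.
Qed.

Lemma ec_line_quad x1 y1 x2 y2 xs ys x3 y3 xt yt l m k n :
  ec_line x1 y1 x2 y2 xs (- ys) l m -> ec_line xs ys x3 y3 xt yt k n ->
  [/\ m + n = - (l + k) * xs,
      x3 + xt = x1 + x2 - (l + k) * (l - k) &
      x3 * xt = x1 * x2 + (l + k) * (m - n)].
Proof.
case=> [[e1 e2 es] [h2 h4 h6]] [[f1 f2 f3] [g2 g4 g6]].
have F0 : m + n = - (l + k) * xs.
  apply: subr0_eq; rewrite -(subrr ys) -{2}[ys]opprK es {1}f1; ring.
have F1 : x3 + xt = x1 + x2 - (l + k) * (l - k).
  have := h2; rewrite g2 => h.
  have -> : x3 + xt = k ^+ 2 - (k ^+ 2 - (xs + x3 + xt)) - xs by ring.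
  by rewrite h; ring.
split=> //.
have := h4; rewrite g4 => h.
have -> : x3 * xt = 2 * k * n + (xs * x3 + xs * xt + x3 * xt)
  - 2 * k * n - xs * (x3 + xt) by ring.
rewrite h F1.
have -> : n = - (l + k) * xs - m by rewrite -F0; ring.
ring.
Qed.

Lemma ec_assoc_aff x1 y1 x2 y2 x3 y3 xs ys xt yt xu yu xv yv
    l m k n l' m' k' n' :
  ec_line x1 y1 x2 y2 xs (- ys) l m -> ec_line xs ys x3 y3 xt (- yt) k n ->
  ec_line x2 y2 x3 y3 xu (- yu) l' m' -> ec_line xu yu x1 y1 xv (- yv) k' n' ->
  x1 != x3 -> x2 != x3 -> (x1 = x2 -> y1 = y2) -> xt = xv /\ yt = yv.
Proof.
move=> L12 LS L23 LU d13 d23 d12.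
have [F0 F1 F2] := ec_line_quad L12 LS.
have [H0 H1 H2] := ec_line_quad L23 LU.
have nop := ec_line_nopp LS; have nop12 := ec_line_nopp L12.
case: (L12) => [[e1 e2 es] [h2 h4 h6]].
case: (L23) => [[p1 p2 pu] [q2 q4 q6]].
case: (LS) => [[r1 r2 rt] _]; case: (LU) => [[s1 s2 sv] _].
set c := l + k in F0 F1 F2; set c' := l' + k' in H0 H1 H2.
pose a := c * l - x1 - x2; pose b := c * m + x1 * x2.
pose a' := c' * l' - x2 - x3; pose b' := c' * m' + x2 * x3.
have d3 : c * (y3 - l * x3 - m) = (x3 - x1) * (x3 - x2).
  have -> : (x3 - x1) * (x3 - x2) = x3 ^+ 2 - (x1 + x2) * x3 + x1 * x2 by ring.
  have -> : x1 * x2 = x3 * xt - c * (m - n) by rewrite F2; ring.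
  have -> : x1 + x2 = x3 + xt + c * (l - k) by rewrite F1; ring.
  by rewrite r2; ring.
have d3n : (x3 - x1) * (x3 - x2) != 0.
  by rewrite mulf_neq0 // subr_eq0 eq_sym.
have c0 : c != 0 by apply: contra_neq d3n => c0; rewrite -d3 c0 mul0r.
have d0 : y3 - l * x3 - m != 0.
  by apply: contra_neq d3n => d0; rewrite -d3 d0 mulr0.
have G1 : x1 ^+ 2 + a * x1 + b = c * y1 by rewrite /a /b e1; ring.
have G3 : x3 ^+ 2 + a * x3 + b = c * y3.
  have -> : c * y3 = c * (y3 - l * x3 - m) + c * (l * x3 + m) by ring.
  by rewrite d3 /a /b; ring.
have G3' : x3 ^+ 2 + a' * x3 + b' = c' * y3 by rewrite /a' /b' p2; ring.
have d1' : c' * (y1 - l' * x1 - m') = (x1 - x2) * (x1 - x3).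
  have -> : (x1 - x2) * (x1 - x3) = x1 ^+ 2 - (x2 + x3) * x1 + x2 * x3 by ring.
  have -> : x2 * x3 = x1 * xv - c' * (m' - n') by rewrite H2; ring.
  have -> : x2 + x3 = x1 + xv + c' * (l' - k') by rewrite H1; ring.
  by rewrite s2; ring.
have G1' : x1 ^+ 2 + a' * x1 + b' = c' * y1.
  have -> : c' * y1 = c' * (y1 - l' * x1 - m') + c' * (l' * x1 + m') by ring.
  by rewrite d1' /a' /b'; ring.
have Al : a - a' = (c - c') * l.
  have [e|ne] := eqVneq x1 x2.
    have ey := d12 e.
    have y0 : y1 != 0.
      by apply/eqP => y0; move: nop12; rewrite -ey -e y0 oppr0 !eqxx.
    have E1 : 2 * l * y1 = 3 * x1 ^+ 2 + 2 * a2 * x1 + a4.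
      by rewrite h4 h2 e1 -e; ring.
    have E2 : 3 * x1 ^+ 2 + 2 * a2 * x1 + a4
              = 2 * l' * y1 + (x1 - x3) * (x1 - xu).
      by rewrite q4 q2 ey p1 -e; ring.
    have E3 : 2 * y1 = c' * (x1 - xu).
      have -> : c' * (x1 - xu) = c' * x1 + - c' * xu by ring.
      rewrite -H0 (_ : 2 * y1 = y1 + y1); last by ring.
      by rewrite {1}ey p1 -e s2 /c'; ring.
    have E4 : c' * (l - l') = x1 - x3.
      have y20 : 2 * y1 != 0 by rewrite mulf_neq0 ?ec_two_neq0.
      apply: (mulfI y20).
      have -> : 2 * y1 * (c' * (l - l')) = c' * (2 * l * y1 - 2 * l' * y1).
        by ring.
      by rewrite E1 E2 E3; ring.
    rewrite /a /a' -e; apply: subr0_eq.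
    have -> : c * l - x1 - x1 - (c' * l' - x1 - x3) - (c - c') * l
      = c' * (l - l') - (x1 - x3) by ring.
    by rewrite E4 subrr.
  have x0 : x1 - x2 != 0 by rewrite subr_eq0.
  apply: (mulIf x0).
  have -> : (a - a') * (x1 - x2) = (x1 ^+ 2 + a * x1 + b)
    - (x1 ^+ 2 + a' * x1 + b')
    - ((x2 ^+ 2 + a * x2 + b) - (x2 ^+ 2 + a' * x2 + b')) by ring.
  have -> : x2 ^+ 2 + a * x2 + b = c * y2 by rewrite /a /b e2; ring.
  have -> : x2 ^+ 2 + a' * x2 + b' = c' * y2 by rewrite /a' /b' p1; ring.
  by rewrite G1 G1' e1 e2; ring.
have Bl : b - b' = (c - c') * m.
  have -> : b - b' = (x1 ^+ 2 + a * x1 + b) - (x1 ^+ 2 + a' * x1 + b')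
    - (a - a') * x1 by ring.
  by rewrite G1 G1' Al e1; ring.
have ec : c = c'.
  apply: subr0_eq; apply: (mulIf d0); rewrite mul0r.
  have -> : (c - c') * (y3 - l * x3 - m) = c * y3 - c' * y3
    - (c - c') * l * x3 - (c - c') * m by ring.
  by rewrite -Al -Bl -G3 -G3'; ring.
have ea : a = a' by apply: subr0_eq; rewrite Al ec subrr mul0r.
have eb : b = b' by apply: subr0_eq; rewrite Bl ec subrr mul0r.
have xt_eq : xt = c ^+ 2 - 2 * a - x1 - x2 - x3.
  have -> : xt = x3 + xt - x3 by ring.
  by rewrite F1 /a /c; ring.
have xv_eq : xv = c' ^+ 2 - 2 * a' - x1 - x2 - x3.
  have -> : xv = x1 + xv - x1 by ring.
  by rewrite H1 /a' /c'; ring.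
have ex : xt = xv by rewrite xt_eq xv_eq ec ea.
split=> //; apply: (mulfI c0).
have -> : c * yt = - (xt ^+ 2 + a * xt + b).
  rewrite -[yt]opprK rt /a /b.
  have -> : x1 * x2 = x3 * xt - c * (m - n) by rewrite F2; ring.
  have -> : c * l - x1 - x2 = c * l - (x3 + xt + c * (l - k)).
    by rewrite F1; ring.
  ring.
rewrite ec -[yv]opprK sv ex ea eb /a' /b'.
have -> : x2 * x3 = x1 * xv - c' * (m' - n') by rewrite H2; ring.
have -> : c' * l' - x2 - x3 = c' * l' - (x1 + xv + c' * (l' - k')).
  by rewrite H1; ring.
ring.
Qed.

Lemma ec_negD p q : ec_on p -> ec_on q ->
  ec_neg (ec_add p q) = ec_add (ec_neg p) (ec_neg q).
Proof.
case: p q => [[x1 y1]|] [[x2 y2]|] // c1 c2.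
have [nop|nop] := boolP ((x1 == x2) && (y1 == - y2)).
  rewrite /ec_add nop; move: nop => /andP [/eqP -> /eqP ->] /=.
  by rewrite !eqxx.
have [x3 [y3 [l [m [L ->]]]]] := ec_addP c1 c2 nop.
by rewrite (ec_line_add (ec_line_neg L)) opprK.
Qed.

Lemma ec_oppP x1 y1 x2 y2 :
  Some (x2, y2) != ec_neg (Some (x1, y1)) -> ~~ ((x1 == x2) && (y1 == - y2)).
Proof. by apply: contra => /andP [/eqP -> /eqP ->] /=; rewrite opprK. Qed.

Lemma ec_same_x_eq x1 y1 x2 y2 :
  ec_on (Some (x1, y1)) -> ec_on (Some (x2, y2)) ->
  Some (x2, y2) != ec_neg (Some (x1, y1)) -> x1 = x2 -> y1 = y2.
Proof.
move=> c1 c2 /ec_oppP nop e; case: (ec_same_x c1 c2 e) => // h.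
by move: nop; rewrite e h !eqxx.
Qed.

Lemma ec_addA p q r : ec_on p -> ec_on q -> ec_on r ->
  ec_add p (ec_add q r) = ec_add (ec_add p q) r.
Proof.
move=> cp cq cr.
have [epr|npr] := eqVneq p r.
  by rewrite -epr [RHS]ec_addC ?ec_add_on // [ec_add q p]ec_addC.
have addKV s t : ec_on s -> ec_on t -> ec_add (ec_neg s) (ec_add s t) = t.
  move=> cs ct; rewrite [ec_add s t]ec_addC //.
  by rewrite ec_addC ?ec_add_on ?ec_neg_on // ec_addK.
have addN s : ec_on s -> ec_add s (ec_neg s) = None.
  by move=> cs; rewrite ec_addC ?ec_neg_on // ec_addN.
have [eqp|nqp] := eqVneq q (ec_neg p).
  rewrite eqp addN // -{1}[p]ec_negK addKV ?ec_neg_on //.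
have [erq|nrq] := eqVneq r (ec_neg q).
  by rewrite erq ec_addK // addN // ec_add0.
have [erp|nrp] := eqVneq r (ec_neg p).
  rewrite erp [ec_add q _]ec_addC ?ec_neg_on // -{1}[p]ec_negK.
  rewrite addKV ?ec_neg_on //.
  by rewrite [ec_add p q]ec_addC // ec_addK.
have [erS|nrS] := eqVneq r (ec_neg (ec_add p q)).
  rewrite erS addN ?ec_add_on // [ec_add p q]ec_addC // ec_negD //.
  have -> : ec_add q (ec_add (ec_neg q) (ec_neg p)) = ec_neg p.
    by rewrite -{1}[q]ec_negK addKV ?ec_neg_on.
  by rewrite addN.
have [epU|npU] := eqVneq p (ec_neg (ec_add q r)).
  rewrite {1}epU ec_addN epU ec_negD //.
  rewrite [ec_add (ec_neg q) _]ec_addC ?ec_neg_on //.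
  have -> : ec_add (ec_add (ec_neg r) (ec_neg q)) q = ec_neg r.
    by rewrite -{2}[q]ec_negK ec_addK ?ec_neg_on.
  by rewrite ec_addN.
case: p q r => [[x1 y1]|] [[x2 y2]|] [[x3 y3]|] //
  in cp cq cr npr nqp nrq nrp nrS npU *; last by rewrite !ec_add0.
have cS := ec_add_on cp cq; have cU := ec_add_on cq cr.
rewrite [LHS]ec_addC //.
have [xs [ys [l [m [L12 eS]]]]] := ec_addP cp cq (ec_oppP nqp).
have [xu [yu [l' [m' [L23 eU]]]]] := ec_addP cq cr (ec_oppP nrq).
rewrite eS in nrS cS *; rewrite eU in npU cU *.
have [xt [yt [k [n [LS ->]]]]] := ec_addP cS cr (ec_oppP nrS).
have [xv [yv [k' [n' [LU ->]]]]] := ec_addP cU cp (ec_oppP npU).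
have d13 : x1 != x3.
  apply/eqP => e; move/eqP: npr; apply.
  by rewrite e (ec_same_x_eq cp cr nrp e).
have [e23|d23] := eqVneq x2 x3; last first.
  have [-> ->] // := ec_assoc_aff L12 LS L23 LU d13 d23
    (ec_same_x_eq cp cq nqp).
have [|||-> ->] // := ec_assoc_aff (ec_line_swap L23) LU (ec_line_swap L12) LS.
- by rewrite eq_sym.
- by rewrite e23 eq_sym.
- by move=> e32; rewrite (ec_same_x_eq cq cr nrq e23).
Qed.

End RawGroupLaw.

Record ec_point (K : fieldType) (E : ellcurve K) := ECPoint {
  ec_val : option (K * K);
  ec_valP : ec_on E ec_val
}.

Section GroupLaw.
Variables (K : fieldType) (E : ellcurve K).
Local Notation point := (ec_point E).

HB.instance Definition _ := [isSub of point for @ec_val K E].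
HB.instance Definition _ := [Choice of point by <:].

Definition ec_point_zero : point := @ECPoint K E None isT.
Definition ec_point_opp (p : point) : point :=
  ECPoint (ec_neg_on (ec_valP p)).
Definition ec_point_add (p q : point) : point :=
  ECPoint (ec_add_on (ec_valP p) (ec_valP q)).

Lemma ec_point_addA : associative ec_point_add.
Proof. by move=> p q r; apply: val_inj; apply: ec_addA; apply: ec_valP. Qed.
Lemma ec_point_addC : commutative ec_point_add.
Proof. by move=> p q; apply: val_inj; apply: ec_addC; apply: ec_valP. Qed.
Lemma ec_point_add0 : left_id ec_point_zero ec_point_add.
Proof. by move=> p; apply: val_inj. Qed.
Lemma ec_point_addN : left_inverse ec_point_zero ec_point_opp ec_point_add.
Proof. by move=> p; apply: val_inj; apply: ec_addN. Qed.

HB.instance Definition _ := GRing.isZmodule.Build point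
  ec_point_addA ec_point_addC ec_point_add0 ec_point_addN.

End GroupLaw.

Definition zindependent (V : zmodType) (n : nat) (v : 'I_n -> V) : Prop :=
  forall c : 'I_n -> int, \sum_(i < n) v i *~ c i = 0 -> forall i, c i = 0.

(* Torsion-free rank: the largest size of a Z-linearly independent family.  On
   a finitely generated group it is the rank of the free part. *)
Definition has_zrank (V : zmodType) (r : nat) : Prop :=
  (exists v : 'I_r -> V, zindependent v) /\
  (forall (n : nat) (v : 'I_n -> V), zindependent v -> (n <= r)%N).

Definition torsion (V : zmodType) (x : V) : Prop :=
  exists2 n : nat, (0 < n)%N & x *+ n = 0.

(* An isomorphism from G onto the torsion subgroup of V, seen as an injective
   morphism into V. *)
Definition torsion_isog (V G : zmodType) : Prop :=
  exists f : {additive G -> V},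
    injective f /\ (forall x, torsion x <-> exists g, x = f g).

Definition torsion_generated_by (V : zmodType) (P : V) : Prop :=
  forall x, torsion x <-> exists k : int, x = P *~ k.

Definition Qa : fieldType := {fraction {poly rat}}.

Definition Qa_var : Qa := FracField.tofrac 'X.

Lemma E24_smooth :
  weierstrass_disc (4 * Qa_var - 1) (16 * Qa_var)
    (64 * Qa_var ^+ 2 - 16 * Qa_var) != 0.
Proof.
have discE (K : fieldType) (a : K) :
    weierstrass_disc (4 * a - 1) (16 * a) (64 * a ^+ 2 - 16 * a)
    = - (1024%:R * a * (4%:R * a + 1) ^+ 4).
  by rewrite /weierstrass_disc; ring.
rewrite discE {discE}.
have nz : 4%:R * 'X + 1 != 0 :> {poly rat}.
  apply/eqP => /(congr1 (fun p : {poly rat} => p.[0])) /eqP.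
  by rewrite !hornerE.
have n0 : 1024%:R * 'X * (4%:R * 'X + 1) ^+ 4 != 0 :> {poly rat}.
  rewrite !mulf_eq0 (negbTE nz) polyX_eq0.
  by rewrite -polyC_natr polyC_eq0.
suff -> : 1024%:R * Qa_var * (4%:R * Qa_var + 1) ^+ 4
    = FracField.tofrac (1024%:R * 'X * (4%:R * 'X + 1) ^+ 4) :> Qa.
  by rewrite oppr_eq0 tofrac_eq0.
rewrite tofracM tofracM tofracXn [tofrac (4%:R * 'X + 1)]tofracD tofracM.
by rewrite !tofracMn tofrac1.
Qed.

Definition E24 : ellcurve Qa :=
  @EllCurve Qa (4 * Qa_var - 1) (16 * Qa_var) (64 * Qa_var ^+ 2 - 16 * Qa_var)
    E24_smooth.

(* Main.v *)
Require Import Defs.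
From HB Require Import structures.
From mathcomp Require Import all_boot all_order all_algebra all_field.
From mathcomp Require Import ring generic_quotient.

Set Implicit Arguments.
Unset Strict Implicit.
Unset Printing Implicit Defensive.

Import GRing.Theory Num.Theory.
Local Open Scope ring_scope.

(* Put X = x + 4a - 1 and b = 1 + 4a.  The curve becomes
   y^2 = X (X^2 + 2(1 - 4a) X + b^2), with P at X = b and 2P = (0, 0).
   By unique factorisation, a nonzero X is a square or b times a square in
   algC(a).  If X = b (m/e)^2, then (m^2 + e^2)^2 + 4a (m^2 - e^2)^2 is a
   square; an infinite descent on the degrees of the polynomials m, e gives
   m^2 = e^2, so X = b and the point is P or -P.  If X is a square, then adding
   P leads back to the first case, because the product of the X-coordinates of
   three collinear points is a square.  Hence the whole group is
   {0, P, 2P, -P}. *)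

(** * Squares of polynomials and the descent *)

Section PolySquares.
Variable C : numClosedFieldType.
Implicit Types (p q u v w : {poly C}) (F G J L M N : {poly C}) (c : C).

Lemma polyC_square c : c != 0 -> 
  exists2 d, d != 0 & c%:P = d%:P ^+ 2 :> {poly C}.
Proof.
by exists (sqrtC c); rewrite ?sqrtC_eq0 // -polyC_exp sqrtCK.
Qed.

Lemma two_poly_neq0 : 2 != 0 :> {poly C}.
Proof. by rewrite -polyC_natr polyC_eq0 pnatr_eq0. Qed.

Lemma eqp_mul_const p q : p %= q -> exists2 c, c != 0 & p = c%:P * q.
Proof.
case/eqpP=> [[c1 c2]] /= /andP [c10 c20] e; exists (c1^-1 * c2).
  by rewrite mulf_neq0 ?invr_eq0.
by rewrite mul_polyC -scalerA -e scalerA mulVf ?scale1r.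
Qed.

Lemma eqp_square p q : p %= q ^+ 2 -> exists s, p = s ^+ 2.
Proof.
case/eqp_mul_const=> c /polyC_square [d _ ->] ->.
by exists (d%:P * q); rewrite exprMn.
Qed.

(** With [g = gcdp u w], [u = u1 * g] and [w = w1 * g], the hypothesis becomes
    [u1 * v = g * w1 ^+ 2]. Since [u1] is coprime to [w1], it divides [g]; since [g] divides [u], it
    is coprime to [v] and divides [u1]. So [u] is [g ^+ 2] up to a constant, and constants are
    squares in [C]. *)
Lemma coprimep_mul_square u v w :
  coprimep u v -> u * v = w ^+ 2 -> exists s, u = s ^+ 2.
Proof.
move=> cuv uvw; have [w0|wn0] := eqVneq w 0.
  have /eqP : u * v = 0 by rewrite uvw w0 expr0n.
  rewrite mulf_eq0 => /orP [/eqP ->|/eqP v0]; first by exists 0; rewrite expr0n.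
  move: cuv; rewrite v0 coprimep0 => u1.
  by apply: (@eqp_square u 1); rewrite expr1n.
have cop : coprimep (u %/ gcdp u w) (w %/ gcdp u w).
  by apply: coprimep_div_gcd; rewrite wn0 orbT.
have gn0 : gcdp u w != 0 by rewrite gcdp_eq0 (negbTE wn0) andbF.
have := divpK (dvdp_gcdr u w); have := divpK (dvdp_gcdl u w).
move: (dvdp_gcdl u w) cop gn0; set g := gcdp u w.
set u1 := u %/ g; set w1 := w %/ g => gu cop gn0 eu ew.
have e : u1 * v = g * w1 ^+ 2.
  apply: (mulIf gn0); rewrite -[in RHS]mulrA [w1 ^+ 2 * g]mulrC mulrA.
  have -> : g * g * w1 ^+ 2 = (w1 * g) ^+ 2 by ring.
  by rewrite ew -uvw -[u in RHS]eu; ring.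
have u1g : u1 %| g.
  rewrite -(@Gauss_dvdpl _ g (w1 ^+ 2)) ?coprimep_expr // -e dvdp_mulr //.
have gu1 : g %| u1.
  rewrite -(@Gauss_dvdpl _ u1 v); first by rewrite e dvdp_mulr.
  exact: coprimep_dvdr gu cuv.
apply: (@eqp_square _ g); rewrite -eu expr2 eqp_mulr //.
by rewrite /eqp u1g gu1.
Qed.

Lemma square_cancel u v w : v != 0 -> u * v ^+ 2 = w ^+ 2 ->
  exists s, u = s ^+ 2.
Proof.
move=> v0 e; have : v %| w by rewrite -(@dvdp_pexp2r _ v w 2) // -e dvdp_mull.
move=> /divpK ew; exists (w %/ v).
by apply: (mulIf (expf_neq0 2 v0)); rewrite e -[in LHS]ew exprMn.
Qed.

(** Four-number lemma: take [f1 = gcdp u p]; the cofactor [f2] of [u] is coprime to the cofactor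
    [g1] of [p], hence divides [q]. *)
Lemma mul_eq_mul_split p q u v : u != 0 -> p * q = u * v ->
  exists f1 f2 g1 g2, [/\ p = f1 * g1, q = f2 * g2, u = f1 * f2 & v = g1 * g2].
Proof.
move=> u0 e.
have gn0 : gcdp u p != 0 by rewrite gcdp_eq0 (negbTE u0).
have cop : coprimep (u %/ gcdp u p) (p %/ gcdp u p).
  by apply: coprimep_div_gcd; rewrite u0.
have := divpK (dvdp_gcdr u p); have := divpK (dvdp_gcdl u p).
move: cop gn0; set g := gcdp u p.
set f2 := u %/ g; set g1 := p %/ g => cop gn0 eu ep.
have e' : g1 * q = f2 * v.
  by apply: (mulfI gn0); rewrite !mulrA ![g * _]mulrC ep eu.
have f20 : f2 != 0 by apply: contra_neq u0 => f20; rewrite -eu f20 mul0r.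
have f2q : f2 %| q by rewrite -(@Gauss_dvdpr _ q g1) // e' dvdp_mulr.
have eq := divpK f2q.
exists g, f2, g1, (q %/ f2); split; rewrite 1?mulrC //.
by apply: (mulfI f20); rewrite -e' -{1}eq; ring.
Qed.


Lemma root0_factor p : p.[0] = 0 -> exists q, p = 'X * q.
Proof.
move/eqP/factor_theorem=> [q ->]; exists q.
by rewrite polyC0 subr0 mulrC.
Qed.

Lemma horner_eq0_two c : 2 * c = 0 -> c = 0.
Proof. by move/eqP; rewrite mulf_eq0 pnatr_eq0 => /eqP. Qed.

Lemma coprimep_sqr p q : coprimep (p ^+ 2) (q ^+ 2) -> coprimep p q.
Proof. by rewrite coprimep_pexpl // coprimep_pexpr. Qed.

(** At a common root of the sum and the difference, [2 * p] vanishes, hence [p] and then [q] do. *)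
Lemma coprimep_addsub p q : coprimep p q -> coprimep (p + q) (p - q).
Proof.
move=> cpq; apply: Pdiv.ClosedField.root_coprimep => z /rootP hU.
apply/eqP=> hV; move: hU hV; rewrite !hornerE => hU hV.
have p0 : p.[z] = 0.
  apply: horner_eq0_two; rewrite -[RHS](addr0 0) -{1}hU -hV; ring.
have /negP := coprimep_root cpq (introT rootP p0); apply.
by move: hU; rewrite p0 add0r => ->.
Qed.

(* With s and r as new m and e, this is again the quartic of quartic_trivial, in
   half the degree. *)
Lemma intersection_descent F G J L : coprimep F G ->
  F ^+ 2 - G ^+ 2 = J ^+ 2 -> F ^+ 2 + 4 * 'X * G ^+ 2 = L ^+ 2 ->
  exists s r, [/\ coprimep s r, F + G = s ^+ 2, F - G = r ^+ 2 &
    (2 * L) ^+ 2 = (s ^+ 2 + r ^+ 2) ^+ 2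
                   + 4 * 'X * (s ^+ 2 - r ^+ 2) ^+ 2].
Proof.
move=> cFG eJ eL; have cop := coprimep_addsub cFG.
have [s es] : exists s, F + G = s ^+ 2.
  by apply: (coprimep_mul_square cop (w := J)); rewrite -eJ; ring.
have [r er] : exists r, F - G = r ^+ 2.
  rewrite coprimep_sym in cop.
  by apply: (coprimep_mul_square cop (w := J)); rewrite -eJ; ring.
exists s, r; split=> //; first by apply: coprimep_sqr; rewrite -es -er.
by rewrite -es -er exprMn -eL; ring.
Qed.

(* The factors N + M and N - M of 4aD^2, where M = m^2 + e^2 and D = m^2 - e^2,
   are coprime, so they are a square and a times a square. *)
Lemma quartic_split (m e N : {poly C}) : coprimep m e ->
  N ^+ 2 = (m ^+ 2 + e ^+ 2) ^+ 2 + 4 * 'X * (m ^+ 2 - e ^+ 2) ^+ 2 ->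
  exists f g, [/\ coprimep f g, f * g = 2 * (m ^+ 2 - e ^+ 2) &
    f ^+ 2 - 'X * g ^+ 2 = 2 * (m ^+ 2 + e ^+ 2)].
Proof.
move=> cme; set M := m ^+ 2 + e ^+ 2; set D := m ^+ 2 - e ^+ 2 => eN.
have eP : (N + M) * (N - M) = 4 * 'X * D ^+ 2.
  have -> : (N + M) * (N - M) = N ^+ 2 - M ^+ 2 by ring.
  by rewrite eN; ring.
have X0 : 'X != 0 :> {poly C} by rewrite polyX_eq0.
have cop : coprimep (N + M) (N - M).
  apply: Pdiv.ClosedField.root_coprimep => z /rootP hU; apply/eqP=> hV.
  have M0 : M.[z] = 0.
    apply: horner_eq0_two; rewrite -[RHS](subr0 0) -{1}hU -hV.
    rewrite !(hornerD, hornerN); ring.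
  have D0 : D.[z] = 0.
    have : (4 * 'X * D ^+ 2).[z] == 0 by rewrite -eP hornerM hU mul0r.
    rewrite -polyC_natr !(hornerM, hornerC, hornerX, horner_exp).
    rewrite !mulf_eq0 pnatr_eq0 orFb.
    case/orP=> [/eqP z0|/orP [] /eqP //].
    (* At [z = 0] the factor ['X] vanishes by itself. But then ['X] divides both [N + M] and
       [N - M], so ['X ^+ 2] divides [4 * 'X * D ^+ 2], and [D] still vanishes at 0. *)
    move: hU hV; rewrite z0 => /root0_factor [U eU] /root0_factor [V eV].
    have : (4 * D ^+ 2).[0] == 0.
      have -> : 4 * D ^+ 2 = 'X * (U * V).
        apply: (mulfI X0).
        rewrite mulrCA mulrA -eP eU eV; ring.
      by rewrite hornerM hornerX mul0r.
    rewrite -polyC_natr !(hornerM, hornerC) !mulf_eq0 pnatr_eq0 orFb.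
    by case/orP=> /eqP.
  have m0 : m.[z] = 0.
    apply/eqP; rewrite -sqrf_eq0; apply/eqP/horner_eq0_two.
    rewrite -[RHS](addr0 0) -{1}M0 -D0 /M /D !(hornerD, hornerN, horner_exp).
    ring.
  have /negP := coprimep_root cme (introT rootP m0); apply.
  move/eqP: M0.
  by rewrite /M hornerD !horner_exp m0 expr0n add0r sqrf_eq0.
(* [V] is the cofactor of ['X] in whichever of [N + M], [N - M] vanishes at 0, and [U] is the other
   factor. If it is [N + M], both change sign so that the difference is [2 * M] and not
   [- 2 * M]. *)
have [U [V [cUV eUV eM]]] : exists U V,
    [/\ coprimep U V, U * V = (2 * D) ^+ 2 & U - 'X * V = 2 * M].
  have : ((N + M) * (N - M)).[0] == 0 by rewrite eP !hornerE.
  rewrite hornerM mulf_eq0 => /orP [] /eqP /root0_factor [V eV].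
    exists (- (N - M)), (- V); split.
    - rewrite -scaleN1r -[- V]scaleN1r coprimepZl ?coprimepZr //;
        rewrite ?oppr_eq0 ?oner_eq0 //.
      by rewrite coprimep_sym; apply: coprimep_dvdr cop; rewrite eV dvdp_mull.
    - apply: (mulfI X0); rewrite mulrNN mulrCA -eV mulrC eP; ring.
    - rewrite mulrN -eV; ring.
  exists (N + M), V; split.
  - by apply: coprimep_dvdl cop; rewrite eV dvdp_mull.
  - apply: (mulfI X0); rewrite mulrCA -eV eP; ring.
  - rewrite -eV; ring.
have [f ef] := coprimep_mul_square cUV eUV.
have [g eg] : exists g, V = g ^+ 2.
  by rewrite coprimep_sym in cUV; apply: (coprimep_mul_square cUV (w := 2 * D));
    rewrite mulrC.
have cfg : coprimep f g by apply: coprimep_sqr; rewrite -ef -eg.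
(* Only the squares of [f] and [g] are prescribed, so a wrong sign of [f * g] is absorbed into
   [f]. *)
have : (f * g) ^+ 2 == (2 * D) ^+ 2 by rewrite exprMn -ef -eg eUV.
rewrite eqf_sqr => /orP [] /eqP h.
  by exists f, g; split; rewrite // -ef -eg.
exists (- f), g; split.
- by rewrite -scaleN1r coprimepZl // oppr_eq0 oner_eq0.
- by rewrite mulNr h opprK.
- by rewrite sqrrN -ef -eg.
Qed.

Lemma size_mul_two p : size (2 * p) = size p.
Proof. by rewrite -polyC_natr size_Cmul // pnatr_eq0. Qed.

Lemma size_le_two_mul p q u : u != 0 -> p * q = 2 * u -> (size p <= size u)%N.
Proof.
move=> u0 e; rewrite -(size_mul_two u); apply: dvdp_leq.
  by rewrite mulf_neq0 // two_poly_neq0.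
by rewrite -e dvdp_mulr.
Qed.

Lemma size_poly_sqr p : p != 0 -> size (p ^+ 2) = (size p).-1.*2.+1.
Proof.
move=> p0; rewrite expr2 size_mul // -addnn.
move: p0; rewrite -size_poly_gt0; case: (size p) => // k _.
by rewrite addSn addnS.
Qed.

Lemma size_1_4X : size (1 + 4 * 'X : {poly C}) = 2%N.
Proof.
rewrite addrC -polyC_natr -polyC1 size_MXaddC !polyC_eq0 pnatr_eq0 size_polyC.
by rewrite pnatr_eq0.
Qed.

(* F^2 - G^2 and F^2 + 4aG^2 are h J^2 and h K^2 where h divides 1 + 4a; for
   h = 1 + 4a up to a constant, (K, J) satisfies the equations that (F, G) does
   for constant h. *)
Lemma pencil_square F G J K :
  G != 0 -> coprimep F G -> coprimep K J -> J != 0 ->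
  K ^+ 2 * (F ^+ 2 - G ^+ 2) = J ^+ 2 * (F ^+ 2 + 4 * 'X * G ^+ 2) ->
  exists2 c, c != 0 &
    F ^+ 2 - G ^+ 2 = (c%:P * J) ^+ 2 /\
      F ^+ 2 + 4 * 'X * G ^+ 2 = (c%:P * K) ^+ 2 \/
    G ^+ 2 = (c%:P * K) ^+ 2 - (c%:P * J) ^+ 2 /\
      F ^+ 2 = (c%:P * K) ^+ 2 + 4 * 'X * (c%:P * J) ^+ 2.
Proof.
move=> G0 cFG cKJ J0 e.
have J20 : J ^+ 2 != 0 by rewrite expf_neq0.
have dvdJ : J ^+ 2 %| F ^+ 2 - G ^+ 2.
  rewrite -(@Gauss_dvdpr _ (F ^+ 2 - G ^+ 2) (K ^+ 2)).
    by rewrite e dvdp_mulr.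
  by rewrite coprimep_expl // coprimep_expr // coprimep_sym.
have := divpK dvdJ; set h := _ %/ _ => e1; move: (esym e1) => {}e1.
have e2 : F ^+ 2 + 4 * 'X * G ^+ 2 = h * K ^+ 2.
  by apply: (mulfI J20); rewrite -e e1; ring.
set b : {poly C} := 1 + 4 * 'X.
have hG : b * G ^+ 2 = h * (K ^+ 2 - J ^+ 2).
  by rewrite mulrBr -e1 -e2 /b; ring.
have hF : b * F ^+ 2 = h * (K ^+ 2 + 4 * 'X * J ^+ 2).
  have -> : h * (K ^+ 2 + 4 * 'X * J ^+ 2) = h * K ^+ 2 + 4 * 'X * (h * J ^+ 2).
    ring.
  by rewrite -e1 -e2 /b; ring.
have sb : size b = 2%N := size_1_4X.
have b0 : b != 0 by rewrite -size_poly_eq0 sb.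
(* By [hF] and [hG], [h] divides [b * F ^+ 2] and [b * G ^+ 2]; a Bezout relation between the
   coprime [F ^+ 2] and [G ^+ 2] leaves [b]. *)
have hb : h %| b.
  have /Bezout_eq1_coprimepP [[u v] /= uv] : coprimep (F ^+ 2) (G ^+ 2).
    by rewrite coprimep_expl // coprimep_expr.
  have -> : b = u * (b * F ^+ 2) + v * (b * G ^+ 2).
    by rewrite -[LHS]mulr1 -uv; ring.
  by rewrite hF hG dvdp_add // mulrCA dvdp_mulr.
have h0 : h != 0 by apply: contraNneq b0 => h0; rewrite -dvd0p -h0.
(* As [b] has degree one, [h] is a constant or a constant multiple of [b]; the constant is a square
   and goes into [c]. *)
have [sh|sh] := eqVneq (size h) 1%N.
  have /eqp_mul_const [c0 /polyC_square [c cn0 ->] eh] : h %= 1.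
    by rewrite -size_poly_eq1 sh.
  exists c => //; left; rewrite e1 e2 eh; split; ring.
have /eqp_mul_const [c0 /polyC_square [c cn0 ->] eh] : h %= b.
  rewrite -dvdp_size_eqp // sb eqn_leq -{1}sb dvdp_leq //=.
  by move: sh h0; rewrite -size_poly_eq0; case: (size h) => [|[|]].
have eG : G ^+ 2 = (c%:P * K) ^+ 2 - (c%:P * J) ^+ 2.
  by apply: (mulfI b0); rewrite hG eh; ring.
exists c => //; right; split=> //.
apply: (mulfI b0); rewrite hF eh; ring.
Qed.

(** In [f * g = (2 * (m - e)) * (m + e)] from [quartic_split], write [2 * (m - e) = f1 * g1],
    [m + e = f2 * g2], [f = f1 * f2], [g = g1 * g2]. The other equation, times 4, then becomes the
    hypothesis of [pencil_square] for [F = 2 * f2], [G = g1], [J = g2], [K = f1]. All four divide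
    [2 * (m - e)] or [2 * (m + e)], which bounds their sizes. *)
Lemma quartic_to_intersection (m e N : {poly C}) n : coprimep m e ->
  (size m <= n)%N -> (size e <= n)%N -> m ^+ 2 != e ^+ 2 ->
  N ^+ 2 = (m ^+ 2 + e ^+ 2) ^+ 2 + 4 * 'X * (m ^+ 2 - e ^+ 2) ^+ 2 ->
  exists F G J L,
    [/\ coprimep F G, G != 0, (size F <= n)%N & (size G <= n)%N] /\
    F ^+ 2 - G ^+ 2 = J ^+ 2 /\ F ^+ 2 + 4 * 'X * G ^+ 2 = L ^+ 2.
Proof.
move=> cme sm se; rewrite -subr_eq0 => D0 eN.
have [f [g [cfg efg eM]]] := quartic_split cme eN.
have fg0 : f * g != 0 by rewrite efg mulf_neq0 // two_poly_neq0.
have f0 : f != 0 by apply: contra_neq fg0 => ->; rewrite mul0r.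
have e0 : (2 * (m - e)) * (m + e) = f * g by rewrite efg; ring.
have [f1 [f2 [g1 [g2 [ep eq ef eg]]]]] := mul_eq_mul_split f0 e0.
have : (m - e) * (m + e) != 0 by rewrite -subr_sqr.
rewrite mulf_eq0 negb_or => /andP [p0 q0].
move: fg0; rewrite ef eg !mulf_eq0 !negb_or.
case/andP=> /andP [f10 f20] /andP [g10 g20].
have eq2 : (2 * f2) * g2 = 2 * (m + e) by rewrite eq mulrA.
have sD : (size (m + e)%R <= n)%N.
  by rewrite (leq_trans (size_polyD _ _)) // geq_max sm.
have sB : (size (m - e)%R <= n)%N.
  by rewrite (leq_trans (size_polyD _ _)) // geq_max size_polyN sm.
have sF : (size (2 * f2)%R <= n)%N := leq_trans (size_le_two_mul q0 eq2) sD.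
have sJ : (size g2 <= n)%N.
  apply: leq_trans sD; apply: (size_le_two_mul q0 (q := 2 * f2)).
  by rewrite mulrC.
have sK : (size f1 <= n)%N.
  by apply: leq_trans sB; apply: (size_le_two_mul p0 (esym ep)).
have sG : (size g1 <= n)%N.
  by apply: leq_trans sB; apply: (size_le_two_mul p0 (q := f1)); rewrite mulrC.
have cFG : coprimep (2 * f2) g1.
  rewrite -polyC_natr mul_polyC coprimepZl ?pnatr_eq0 //.
  by move: cfg; rewrite ef eg coprimepMl !coprimepMr => /andP [_ /andP [] ].
have cKJ : coprimep f1 g2.
  by move: cfg; rewrite ef eg coprimepMl !coprimepMr => /andP [/andP [] ].
have key : f1 ^+ 2 * ((2 * f2) ^+ 2 - g1 ^+ 2)
    = g2 ^+ 2 * ((2 * f2) ^+ 2 + 4 * 'X * g1 ^+ 2).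
  have : 4 * (f ^+ 2 - 'X * g ^+ 2) = (2 * (m - e)) ^+ 2 + 4 * (m + e) ^+ 2.
    by rewrite eM; ring.
  rewrite ep eq ef eg => h; apply/eqP; rewrite -subr_eq0.
  move/eqP: h; rewrite -subr_eq0 => /eqP <-; apply/eqP; ring.
have [c c0 [[hJ hL]|[hJ hL]]] := pencil_square g10 cFG cKJ g20 key.
  by exists (2 * f2), g1, (c%:P * g2), (c%:P * f1).
(* In the second alternative the two pairs exchange roles: [c K], [c J] become the new [F], [G],
   within the same size bound. *)
exists (c%:P * f1), (c%:P * g2), g1, (2 * f2); split; last by [].
rewrite !size_Cmul // mulf_neq0 ?polyC_eq0 //; split=> //.
by rewrite !mul_polyC coprimepZl // coprimepZr.
Qed.

Lemma quartic_trivial (m e N : {poly C}) : coprimep m e ->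
  N ^+ 2 = (m ^+ 2 + e ^+ 2) ^+ 2 + 4 * 'X * (m ^+ 2 - e ^+ 2) ^+ 2 ->
  m ^+ 2 = e ^+ 2.
Proof.
have [n] := ubnP (maxn (size m) (size e)).
elim: n m e N => // n IH m e N; rewrite ltnS geq_max => /andP [sm se] cme eN.
apply/eqP/negPn/negP=> D0.
have [F [G [J [L [[cFG G0 sF sG] [eJ eL]]]]]] :=
  quartic_to_intersection cme sm se D0 eN.
have [s [r [csr es er eN']]] := intersection_descent cFG eJ eL.
(* The new pair is again a counterexample, because [s ^+ 2 - r ^+ 2 = 2 * G] and [G] is nonzero. *)
have D0' : s ^+ 2 != r ^+ 2.
  rewrite -es -er -subr_eq0.
  have -> : F + G - (F - G) = 2 * G by ring.
  by rewrite mulf_neq0 ?two_poly_neq0.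
(* A nonzero [p] has [size (p ^+ 2) = 2 * size p - 1], so the size drops strictly as soon as [n]
   exceeds 1. *)
have half p : (size (p ^+ 2)%R <= n)%N -> (n <= 1)%N || (size p < n)%N.
  have [->|p0] := eqVneq p 0.
    by rewrite size_poly0; case: n {IH sm se sF sG} => [|[]].
  rewrite (size_poly_sqr p0) -addnn; case: (size p) => [|[|k]] /=.
  - by case: n {IH sm se sF sG} => [|[]].
  - by case: n {IH sm se sF sG} => [|[]].
  rewrite addSn addnS => h; apply/orP; right.
  by apply: leq_trans h; rewrite !ltnS leq_addr.
have ss : (size (s ^+ 2)%R <= n)%N.
  by rewrite -es (leq_trans (size_polyD _ _)) // geq_max sF.
have sr : (size (r ^+ 2)%R <= n)%N.
  by rewrite -er (leq_trans (size_polyD _ _)) // geq_max size_polyN sF.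
have [n1|n1] := leqP n 1; last first.
  move: (half _ ss) (half _ sr); rewrite leqNgt n1 /= => hs hr.
  by move/eqP: D0'; apply; apply: IH eN'; rewrite // gtn_max hs.
(* Base of the descent: [m] and [e] are constants with distinct squares, so [N ^+ 2] would have
   degree one, which is odd. *)
move: D0 eN; rewrite (size1_polyC (leq_trans sm n1)).
rewrite (size1_polyC (leq_trans se n1)).
set a := m`_0; set b := e`_0; rewrite -!polyC_exp -polyCB -polyCD -subr_eq0.
rewrite -polyCB polyC_eq0 => d0 eN.
have sR : size (N ^+ 2) = 2%N.
  rewrite eN addrC mulrAC -polyC_natr -!polyC_exp -polyCM size_MXaddC.
  rewrite polyC_eq0 mulf_eq0 pnatr_eq0 expf_eq0 (negbTE d0) /=.
  by rewrite size_polyC mulf_eq0 pnatr_eq0 expf_eq0 (negbTE d0).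
move: sR; have [->|N0] := eqVneq N 0; first by rewrite expr0n size_poly0.
by rewrite (size_poly_sqr N0); case: (size N) => [|[|[]]].
Qed.

End PolySquares.

(** * Square classes of X-coordinates *)

Section TwoCover.
Variable C : numClosedFieldType.
Implicit Types p q s t w : {poly C}.
Local Notation b := (1 + 4 * 'X : {poly C}).
Local Notation A := (2 * (1 - 4 * 'X) : {poly C}).

Lemma one_4X_neq0 : b != 0.
Proof. by rewrite -size_poly_eq0 size_1_4X. Qed.

Lemma coprimep_1_4X p : ~~ (b %| p) -> coprimep p b.
Proof.
move=> nbp; rewrite coprimep_def; apply/negPn/negP => s1.
have gb := dvdp_gcdr p b.
have g0 : gcdp p b != 0 by rewrite gcdp_eq0 (negbTE one_4X_neq0) andbF.
have sg : (size (gcdp p b) <= 2)%N.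
  by apply: leq_trans (dvdp_leq one_4X_neq0 gb) _; rewrite size_1_4X.
move/negP: nbp; apply.
suff /eqp_dvdl <- : gcdp p b %= b by apply: dvdp_gcdl.
rewrite -dvdp_size_eqp // size_1_4X eqn_leq sg.
by move: g0 s1; rewrite -size_poly_eq0; case: (size _) => [|[]].
Qed.

(** The equation is the curve at [X = p / q] with denominators cleared. Modulo [q] the factor [T] is
    [p ^+ 2], so [q] is coprime to [p * T] and is a square. Modulo [p] it is [b ^+ 2 * q ^+ 2], so
    only [b] can divide both [p] and [T]. The proof separates the cases where [b] divides [p] not at
    all, exactly once, or at least twice; after removing these factors the quotient of [p] is
    coprime to its cofactor, hence a square. *)
Lemma two_cover p q w : coprimep p q ->
  w ^+ 2 = p * q * (p ^+ 2 + A * p * q + b ^+ 2 * q ^+ 2) ->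
  exists s t, q = t ^+ 2 /\ (p = s ^+ 2 \/ p = b * s ^+ 2).
Proof.
set T := _ + b ^+ 2 * _ => cpq ew.
have [t qt] : exists t, q = t ^+ 2.
  apply: (@coprimep_mul_square _ q (p * T) w); last by rewrite ew; ring.
  rewrite coprimepMr coprimep_sym cpq /=.
  have -> : T = (A * p + b ^+ 2 * q) * q + p ^+ 2 by rewrite /T; ring.
  by rewrite coprimep_addl_mul coprimep_expr // coprimep_sym.
suff [s hs] : exists s, p = s ^+ 2 \/ p = b * s ^+ 2 by exists s, t.
have [q0|q0] := eqVneq q 0.
  move: cpq; rewrite q0 coprimep0 -[1](expr1n _ 2) => /eqp_square [s ->].
  by exists s; left.
have [w0 e0] : exists w0, p * T = w0 ^+ 2.
  move: q0; rewrite qt sqrf_eq0 => t0; apply: (square_cancel t0 (w := w)).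
  by rewrite ew qt; ring.
have [/dvdpP [p1 ep]|/coprimep_1_4X cpb] := boolP (b %| p); last first.
  have [|s ->] := coprimep_mul_square _ e0; last by exists s; left.
  have -> : T = (p + A * q) * p + (b * q) ^+ 2 by rewrite /T; ring.
  by rewrite coprimep_addl_mul coprimep_expr // coprimepMr cpb.
have [w1 e1] : exists w1,
    p1 * (b * p1 ^+ 2 + A * p1 * q + b * q ^+ 2) = w1 ^+ 2.
  by apply: (square_cancel one_4X_neq0 (w := w0)); rewrite -e0 /T ep; ring.
have cp1q : coprimep p1 q by apply: coprimep_dvdr cpq; rewrite ep dvdp_mulr.
have [/dvdpP [p2 ep1]|/coprimep_1_4X cpb] := boolP (b %| p1); last first.
  have [|s es] := coprimep_mul_square _ e1.
    have -> : b * p1 ^+ 2 + A * p1 * q + b * q ^+ 2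
       = (b * p1 + A * q) * p1 + b * q ^+ 2 by ring.
    by rewrite coprimep_addl_mul coprimepMr cpb coprimep_expr.
  by exists s; right; rewrite ep es mulrC.
have [w2 e2] : exists w2,
    p2 * (b ^+ 2 * p2 ^+ 2 + A * p2 * q + q ^+ 2) = w2 ^+ 2.
  by apply: (square_cancel one_4X_neq0 (w := w1)); rewrite -e1 ep1; ring.
have cp2q : coprimep p2 q by apply: coprimep_dvdr cp1q; rewrite ep1 dvdp_mulr.
have [|s es] := coprimep_mul_square _ e2.
  have -> : b ^+ 2 * p2 ^+ 2 + A * p2 * q + q ^+ 2
     = (b ^+ 2 * p2 + A * q) * p2 + q ^+ 2 by ring.
  by rewrite coprimep_addl_mul coprimep_expr.
by exists (b * s); left; rewrite ep ep1 es; ring.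
Qed.

(** If [p] were a square, [b] would be one too, against its degree. So [p = b * s ^+ 2] and
    [q = t ^+ 2]; dividing the equation by [(b * s * t) ^+ 2] leaves the quartic of
    [quartic_trivial] in [s] and [t]. *)
Lemma two_cover_b p q w v : coprimep p q -> p != 0 -> q != 0 ->
  w ^+ 2 = p * q * (p ^+ 2 + A * p * q + b ^+ 2 * q ^+ 2) ->
  b * p * q = v ^+ 2 -> p = b * q.
Proof.
move=> cpq p0 q0 ew ev.
have [s [t [qt [ps|ps]]]] := two_cover cpq ew.
  have [r er] : exists r, b = r ^+ 2.
    apply: (square_cancel (v := s * t) (w := v)); last first.
      by rewrite -ev ps qt; ring.
    by move: p0 q0; rewrite ps qt !sqrf_eq0; apply: mulf_neq0.
  have := size_1_4X C; rewrite er size_poly_sqr.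
    by case: (size r) => [|[]].
  by rewrite -sqrf_eq0 -er one_4X_neq0.
have [N eN] : exists N, b * s ^+ 4 + A * s ^+ 2 * t ^+ 2 + b * t ^+ 4 = N ^+ 2.
  apply: (square_cancel (v := b * s * t) (w := w)); last first.
    by rewrite ew ps qt; ring.
  move: p0 q0; rewrite ps qt mulf_eq0 !sqrf_eq0 negb_or => /andP [b0 s0] t0.
  by rewrite !mulf_neq0.
suff st : s ^+ 2 = t ^+ 2 by rewrite ps qt st.
apply: (quartic_trivial (N := N)); last by rewrite -eN; ring.
apply: coprimep_sqr; rewrite -qt; apply: coprimep_dvdr cpq.
by rewrite ps dvdp_mull.
Qed.

End TwoCover.

(** * Clearing denominators in Q(a), and square classes over algC(a) *)

Lemma fraction_repr (R : idomainType) (x : {fraction R}) :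
  exists n d, d != 0 /\ x = FracField.tofrac n / FracField.tofrac d.
Proof.
exists (\n_(repr x)), (\d_(repr x)).
have d0 : \d_(repr x) != 0 by apply: denom_ratioP.
split=> //; apply: (mulIf (_ : FracField.tofrac \d_(repr x) != 0)).
  by rewrite tofrac_eq0.
rewrite divfK ?tofrac_eq0 // -{1}[x]reprK; unlock FracField.tofrac.
rewrite -[LHS]FracField.pi_mul; apply/eqmodP.
rewrite /= FracField.equivfE /FracField.mulf !numden_Ratio ?mulf_neq0 //;
  rewrite ?oner_neq0 //.
by rewrite !mulr1 mulrC.
Qed.

Lemma curve_clear_denom_field (K : fieldType) (a n d p q : K) :
  d != 0 -> q != 0 ->
  (n / d) ^+ 2 = (p / q) * ((p / q) ^+ 2 + 2 * (1 - 4 * a) * (p / q)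
                            + (1 + 4 * a) ^+ 2) ->
  p * q * (p ^+ 2 + 2 * (1 - 4 * a) * p * q + (1 + 4 * a) ^+ 2 * q ^+ 2)
    * d ^+ 2 = (n * q ^+ 2) ^+ 2.
Proof.
move=> d0 q0 e.
have -> : (n * q ^+ 2) ^+ 2 = (n / d) ^+ 2 * (d ^+ 2 * q ^+ 4) by field.
by rewrite e; field.
Qed.

(** For [(p / q) * (p' / q') = (n / d) ^+ 2]: the products [p * q] and [p' * q'] lie in the same
    square class. *)
Lemma mul_frac_squares (R : comNzRingType) (p q p' q' n d : R) :
  p * p' * d ^+ 2 = n ^+ 2 * (q * q') ->
  p' * q' * (p * q * d ^+ 2) = (n * q * q') ^+ 2.
Proof.
move=> e; have -> : p' * q' * (p * q * d ^+ 2) = p * p' * d ^+ 2 * (q * q').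
  by ring.
by rewrite e; ring.
Qed.

(** For two representations [p / q = n / d] of one fraction: the square class of numerator times
    denominator does not change. *)
Lemma cross_mul_squares (R : comNzRingType) (p q n d : R) :
  p * d = n * q -> n * d * q ^+ 2 = p * q * d ^+ 2.
Proof.
move=> e; have -> : n * d * q ^+ 2 = n * q * d * q by ring.
by rewrite -e; ring.
Qed.

Section GeometricSquares.
Local Notation tofrac := (@FracField.tofrac {poly rat}).
Local Notation rho := (map_poly (ratr : rat -> algC)).
Local Notation a := Qa_var.
Local Notation b := (1 + 4 * Qa_var : Qa).

Lemma tofrac_neq0 (p : {poly rat}) : p != 0 -> tofrac p != 0.
Proof. by rewrite tofrac_eq0. Qed.

Lemma rho_neq0 (p : {poly rat}) : p != 0 -> rho p != 0.
Proof. by rewrite map_poly_eq0. Qed.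

Lemma Qa_repr (x : Qa) :
  exists p q, [/\ coprimep p q, q != 0 & x = tofrac p / tofrac q].
Proof.
have [n [d [d0 ->]]] := fraction_repr x.
have cop : coprimep (n %/ gcdp n d) (d %/ gcdp n d).
  by apply: coprimep_div_gcd; rewrite d0 orbT.
have := divpK (dvdp_gcdr n d); have := divpK (dvdp_gcdl n d).
set g := gcdp n d in cop *; set p := n %/ g in cop *; set q := d %/ g in cop *.
move=> en ed; exists p, q.
have q0 : q != 0 by apply: contra_neq d0 => q0; rewrite -ed q0 mul0r.
have g0 : g != 0 by apply: contra_neq d0 => g0; rewrite -ed g0 mulr0.
by split; rewrite // -en -ed !tofracM -mulf_div divff ?mulr1 // tofrac_neq0.
Qed.

(* x becomes a square in algC(a); stated on numerators and denominators, which
   avoids extending ratr to the fraction fields. *)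
Definition geo_square (x : Qa) : Prop :=
  forall p q, q != 0 -> x = tofrac p / tofrac q ->
  exists s, rho (p * q) = s ^+ 2.

Lemma rho_square_cancel (p u w : {poly rat}) : u != 0 -> p * u ^+ 2 = w ^+ 2 ->
  exists s, rho p = s ^+ 2.
Proof.
move=> u0 e; apply: (square_cancel (rho_neq0 u0) (w := rho w)).
by rewrite -!rmorphXn -rmorphM e.
Qed.

Lemma tofrac_div_eq (p q n d : {poly rat}) : q != 0 -> d != 0 ->
  tofrac p / tofrac q = tofrac n / tofrac d -> p * d = n * q.
Proof.
move=> q0 d0 e; apply/eqP; rewrite -tofrac_eq !tofracM; apply/eqP.
by apply/eqP; rewrite -eqr_div ?tofrac_neq0 //; apply/eqP.
Qed.

(** One representation suffices, by [cross_mul_squares]. *)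
Lemma geo_squareI (x : Qa) p q s : q != 0 -> x = tofrac p / tofrac q ->
  rho (p * q) = s ^+ 2 -> geo_square x.
Proof.
move=> q0 -> es n d d0 /(tofrac_div_eq q0 d0) e.
apply: (square_cancel (rho_neq0 q0) (w := s * rho d)).
by rewrite exprMn -es -!rmorphXn -!rmorphM; congr rho; apply: cross_mul_squares.
Qed.

Lemma geo_square_div (x y z : Qa) : x != 0 -> geo_square x ->
  x * y = z ^+ 2 -> geo_square y.
Proof.
move=> x0 sx; have [p [q [_ q0 ex]]] := Qa_repr x.
have [p' [q' [_ q'0 ->]]] := Qa_repr y; have [n [d [_ d0 ->]]] := Qa_repr z.
have [s es] := sx _ _ q0 ex.
have p0 : p != 0 by apply: contra_neq x0 => p0; rewrite ex p0 tofrac0 mul0r.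
have s0 : s != 0.
  by rewrite -sqrf_eq0 -es rho_neq0 // mulf_neq0.
rewrite ex mulf_div exprMn exprVn -!tofracXn -!tofracM => e.
have {}e := tofrac_div_eq (mulf_neq0 q0 q'0) (expf_neq0 2 d0) e.
have v0 : s * rho d != 0 by rewrite mulf_neq0 // rho_neq0.
have [|r er] := square_cancel (u := rho (p' * q')) (w := rho (n * q * q')) v0.
  rewrite exprMn -es -!rmorphXn -!rmorphM; congr rho.
  exact: mul_frac_squares.
exact: geo_squareI q'0 (erefl _) er.
Qed.

Lemma curve_clear_denom (x y : Qa) p q : q != 0 -> x = tofrac p / tofrac q ->
  y ^+ 2 = x * (x ^+ 2 + 2 * (1 - 4 * a) * x + b ^+ 2) ->
  exists w, w ^+ 2 = rho p * rho q * (rho p ^+ 2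
    + 2 * (1 - 4 * 'X) * rho p * rho q + (1 + 4 * 'X) ^+ 2 * rho q ^+ 2).
Proof.
move=> q0 ex; have [n [d [_ d0 ->]]] := Qa_repr y => e.
have [|s es] := @rho_square_cancel (p * q * (p ^+ 2
    + 2 * (1 - 4 * 'X) * p * q + (1 + 4 * 'X) ^+ 2 * q ^+ 2)) d (n * q ^+ 2) d0.
  apply/eqP; rewrite -tofrac_eq; apply/eqP.
  rewrite !(tofracM, tofracD, tofracN, tofracXn, tofracMn, tofrac1) -/a.
  by apply: curve_clear_denom_field; rewrite ?tofrac_neq0 // -ex.
exists s; rewrite -es.
rewrite !(rmorphM, rmorphD, rmorphN, rmorphXn, rmorph1, rmorph_nat) /=.
by rewrite map_polyX.
Qed.

Lemma geo_square_cases (x y : Qa) :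
  y ^+ 2 = x * (x ^+ 2 + 2 * (1 - 4 * a) * x + b ^+ 2) ->
  geo_square x \/ geo_square (b * x).
Proof.
have [p [q [cpq q0 ex]]] := Qa_repr x; move=> e.
have [w ew] := curve_clear_denom q0 ex e.
have cr : coprimep (rho p) (rho q) by rewrite coprimep_map.
have [s [t [et [es|es]]]] := two_cover cr ew.
  left; apply: (geo_squareI q0 ex (s := s * t)).
  by rewrite rmorphM /= es et exprMn.
right; apply: (@geo_squareI _ ((1 + 4 * 'X) * p) q ((1 + 4 * 'X) * s * t) q0).
  rewrite ex tofracM mulrA tofracD tofracM tofrac1 tofracMn tofrac1 //.
rewrite !(rmorphM, rmorphD, rmorph1, rmorph_nat) /= map_polyX es et; ring.
Qed.

Lemma geo_square_b_eq (x y : Qa) : x != 0 ->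
  y ^+ 2 = x * (x ^+ 2 + 2 * (1 - 4 * a) * x + b ^+ 2) ->
  geo_square (b * x) -> x = b.
Proof.
have [p [q [cpq q0 ex]]] := Qa_repr x; move=> x0 e sq.
have [w ew] := curve_clear_denom q0 ex e.
have cr : coprimep (rho p) (rho q) by rewrite coprimep_map.
have eb : b = tofrac (1 + 4 * 'X).
  by rewrite tofracD tofracM tofrac1 tofracMn tofrac1.
have p0 : p != 0 by apply: contra_neq x0 => p0; rewrite ex p0 tofrac0 mul0r.
have [|v ev] := sq ((1 + 4 * 'X) * p) q q0.
  by rewrite ex mulrA tofracM eb.
have epq : rho p = (1 + 4 * 'X) * rho q.
  apply: (two_cover_b cr (rho_neq0 p0) (rho_neq0 q0) ew (v := v)).
  by rewrite -ev !(rmorphM, rmorphD, rmorph1, rmorph_nat) /= map_polyX.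
(* The equality [p = b * q] was found over [algC]; it descends to [rat] because [rho] is
   injective. *)
have -> : x = tofrac ((1 + 4 * 'X) * q) / tofrac q.
  rewrite ex; congr (tofrac _ / _).
  apply: (map_poly_inj (ratr : {rmorphism rat -> algC})).
  by rewrite epq !(rmorphM, rmorphD, rmorph1, rmorph_nat) /= map_polyX.
by rewrite tofracM mulfK ?tofrac_neq0 // eb.
Qed.

End GeometricSquares.

(** * Polynomial identities for the curve, in any commutative ring *)

Lemma E24_shift (R : comNzRingType) (a x y : R) :
  y ^+ 2 = x ^+ 3 + (4 * a - 1) * x ^+ 2 + 16 * a * x
           + (64 * a ^+ 2 - 16 * a) ->
  y ^+ 2 = (x + (4 * a - 1)) * ((x + (4 * a - 1)) ^+ 2
    + 2 * (1 - 4 * a) * (x + (4 * a - 1)) + (1 + 4 * a) ^+ 2).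
Proof. by move->; ring. Qed.

(* The cubic minus the squared line, evaluated at its root x = 1 - 4a. *)
Lemma E24_line_product (R : comNzRingType) (a x1 x2 x3 l m : R) :
  4 * a - 1 = l ^+ 2 - (x1 + x2 + x3) ->
  16 * a = 2 * l * m + (x1 * x2 + x1 * x3 + x2 * x3) ->
  64 * a ^+ 2 - 16 * a = m ^+ 2 - x1 * x2 * x3 ->
  (x1 + (4 * a - 1)) * ((x2 + (4 * a - 1)) * (x3 + (4 * a - 1)))
    = (l * (1 - 4 * a) + m) ^+ 2.
Proof.
move=> h2 h4 h6.
have s1 : x1 + x2 + x3 = l ^+ 2 - (4 * a - 1) by rewrite h2; ring.
have s2 : x1 * x2 + x1 * x3 + x2 * x3 = 16 * a - 2 * l * m by rewrite h4; ring.
have s3 : x1 * x2 * x3 = m ^+ 2 - (64 * a ^+ 2 - 16 * a) by rewrite h6; ring.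
have -> : (x1 + (4 * a - 1)) * ((x2 + (4 * a - 1)) * (x3 + (4 * a - 1)))
  = (4 * a - 1) ^+ 3 + (x1 + x2 + x3) * (4 * a - 1) ^+ 2
    + (x1 * x2 + x1 * x3 + x2 * x3) * (4 * a - 1) + x1 * x2 * x3 by ring.
by rewrite s1 s2 s3; ring.
Qed.

Lemma E24_b_value (R : comNzRingType) (a x y : R) :
  y ^+ 2 = x * (x ^+ 2 + 2 * (1 - 4 * a) * x + (1 + 4 * a) ^+ 2) ->
  x = 1 + 4 * a -> y ^+ 2 = (8 * a + 2) ^+ 2.
Proof. by move=> -> ->; ring. Qed.

Lemma E24_x_value (R : comNzRingType) (a x : R) :
  x + (4 * a - 1) = 1 + 4 * a -> x = 2.
Proof.
move=> e; have -> : x = x + (4 * a - 1) - (4 * a - 1) by ring.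
by rewrite e; ring.
Qed.

Lemma E24_P_shift (R : comNzRingType) (a : R) : 2 + (4 * a - 1) = 1 + 4 * a.
Proof. by ring. Qed.

Lemma E24_P_identity (R : comNzRingType) (a : R) :
  (8 * a + 2) ^+ 2 = 2 ^+ 3 + (4 * a - 1) * 2 ^+ 2 + 16 * a * 2
           + (64 * a ^+ 2 - 16 * a).
Proof. by ring. Qed.

(** The tangent at P is [y = 2 x + 8 a - 2]; it meets the curve again at [(1 - 4 a, 0)]. The shape
    is that of [ec_line], which yields 2P. *)
Lemma E24_tangent_identity (R : comNzRingType) (a : R) :
  [/\ 8 * a + 2 = 2 * 2 + (8 * a - 2), 8 * a + 2 = 2 * 2 + (8 * a - 2)
    & 0 = 2 * (1 - 4 * a) + (8 * a - 2)] /\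
  [/\ 4 * a - 1 = 2 ^+ 2 - (2 + 2 + (1 - 4 * a)),
      16 * a = 2 * 2 * (8 * a - 2) + (2 * 2 + 2 * (1 - 4 * a) + 2 * (1 - 4 * a))
    & 64 * a ^+ 2 - 16 * a = (8 * a - 2) ^+ 2 - 2 * 2 * (1 - 4 * a)].
Proof. by split; split; ring. Qed.

(** * The points of E24 *)

Section Points.
Local Notation a := Qa_var.
Local Notation b := (1 + 4 * Qa_var : Qa).
Local Notation point := (ec_point E24).

Lemma E24_P_on : ec_on E24 (Some (2, 8 * a + 2)).
Proof. by apply/eqP; apply: E24_P_identity. Qed.

Definition E24_P : point := ECPoint E24_P_on.

Lemma E24_2P : val (E24_P *+ 2) = Some (1 - 4 * a, 0).
Proof.
rewrite mulr2n; have L : ec_line E24 2 (8 * a + 2) 2 (8 * a + 2) (1 - 4 * a) 0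
    2 (8 * a - 2) by apply: E24_tangent_identity.
by have := ec_line_add L; rewrite oppr0.
Qed.

Lemma E24_4P : E24_P *+ 4 = 0.
Proof.
rewrite (mulrnA _ 2 2) mulr2n; apply: val_inj => /=.
have /= -> := E24_2P.
by rewrite /ec_add oppr0 !eqxx.
Qed.

Lemma E24_3P : E24_P *+ 3 = - E24_P.
Proof. by apply/eqP; rewrite -addr_eq0 -mulrSr E24_4P. Qed.

Lemma E24_onP x y : ec_on E24 (Some (x, y)) ->
  y ^+ 2 = (x + (4 * a - 1)) * ((x + (4 * a - 1)) ^+ 2
    + 2 * (1 - 4 * a) * (x + (4 * a - 1)) + b ^+ 2).
Proof. by move=> /eqP; apply: E24_shift. Qed.

Lemma E24_vertical (Q : point) x y : val Q = Some (x, y) ->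
  x + (4 * a - 1) = 0 -> Q = E24_P *+ 2.
Proof.
move=> eQ x0; have := ec_valP Q; rewrite /= in eQ; rewrite eQ => /E24_onP.
rewrite x0 mul0r => /eqP; rewrite sqrf_eq0 => /eqP y0.
apply: val_inj; rewrite E24_2P /= eQ y0; congr (Some (_, _)).
by move/eqP: x0; rewrite addr_eq0 opprB => /eqP.
Qed.

(** Zero is also a square, so [X = 0], that is 2P, is handled apart. Otherwise [X = b] and [y] is
    determined up to sign. *)
Lemma E24_coset_P (Q : point) x y : val Q = Some (x, y) ->
  geo_square (b * (x + (4 * a - 1))) ->
  [\/ Q = E24_P, Q = - E24_P | Q = E24_P *+ 2].
Proof.
move=> eQ sq; have [x0|x0] := eqVneq (x + (4 * a - 1)) 0.
  by apply: Or33; apply: E24_vertical eQ x0.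
have := ec_valP Q; rewrite /= in eQ; rewrite eQ => /E24_onP e.
have ex := geo_square_b_eq x0 e sq.
have /eqP := E24_b_value e ex; have {}ex := E24_x_value ex.
by rewrite eqf_sqr => /orP [] /eqP ey; [apply: Or31|apply: Or32];
  apply: val_inj; rewrite /= eQ ex ey.
Qed.

Lemma E24_points (Q : point) : exists k : 'Z_4, Q = E24_P *+ k.
Proof.
suff: [\/ Q = E24_P, Q = - E24_P, Q = E24_P *+ 2 | Q = 0].
  case=> ->; [exists 1|exists 3|exists 2|exists 0] => //.
  by rewrite -E24_3P.
case eQ: (val Q) => [[x y]|]; last by apply: Or44; apply: val_inj.
have onQ : ec_on E24 (Some (x, y)).
  by have := ec_valP Q; rewrite /= in eQ; rewrite eQ.
have [sx|/(E24_coset_P eQ) []] := geo_square_cases (E24_onP onQ); last first.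
- exact: Or43.
- exact: Or42.
- exact: Or41.
have [x0|x0] := eqVneq (x + (4 * a - 1)) 0.
  by apply: Or43; apply: E24_vertical eQ x0.
(* [Q = - P] is set aside, since then [Q + P] is at infinity and has no X-coordinate. *)
have [nop|nop] := boolP ((x == 2) && (y == - (8 * a + 2))).
  apply: Or42; apply: val_inj; case/andP: nop => /eqP ex /eqP ey.
  by rewrite [LHS]eQ ex ey.
have [x3 [y3 [l [m [[_ [h2 h4 h6]] eS]]]]] := ec_addP onQ E24_P_on nop.
have eQP : val (Q + E24_P) = Some (x3, y3) by rewrite -eS -eQ.
(* The X-coordinates of Q, P and Q + P multiply to a square; that of Q is a nonzero square and that
   of P is [b]. *)
have sq : geo_square (b * (x3 + (4 * a - 1))).
  apply: (geo_square_div x0 sx (z := l * (1 - 4 * a) + m)).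
  rewrite -(E24_P_shift a); exact: E24_line_product h2 h4 h6.
have eK : Q = Q + E24_P - E24_P by rewrite addrK.
(* Subtracting P from P, -P and 2P gives 0, -2P = 2P and P. *)
case: (E24_coset_P eQP sq) => e; move: eK; rewrite e => ->.
- by apply: Or44; rewrite subrr.
- apply: Or43; rewrite -opprD -mulr2n; apply/eqP.
  by rewrite eq_sym -addr_eq0 -mulrnDr E24_4P.
- by apply: Or41; rewrite mulr2n addrK.
Qed.

Lemma E24_P_mod k : E24_P *+ (k %% 4) = E24_P *+ k.
Proof.
rewrite [in RHS](divn_eq k 4) mulrnDr mulnC mulrnA E24_4P.
by rewrite mul0rn add0r.
Qed.

Definition E24_multiple (k : 'Z_4) : point := E24_P *+ k.

Lemma E24_multiple_is_zmod_morphism : zmod_morphism E24_multiple.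
Proof.
have D k l : E24_multiple (k + l) = E24_multiple k + E24_multiple l.
  by rewrite /E24_multiple /= E24_P_mod mulrnDr.
by move=> k l; apply/eqP; rewrite eq_sym subr_eq -D subrK.
Qed.

HB.instance Definition _ := GRing.isZmodMorphism.Build 'Z_4 point E24_multiple
  E24_multiple_is_zmod_morphism.

Lemma E24_multiple_inj : injective E24_multiple.
Proof.
apply: raddf_inj => -[[|[|[|[|k]]]] lt_k] // e; apply: val_inj => //.
- by have : E24_P *+ 2 = 0 := e; move/(congr1 val); rewrite E24_2P.
- have : E24_P *+ 3 = 0 := e.
  by rewrite E24_3P => /eqP; rewrite oppr_eq0 => /eqP/(congr1 val).
Qed.

Lemma E24_torsion (Q : point) : Q *+ 4 = 0.
Proof.
have [k ->] := E24_points Q.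
by rewrite -mulrnA mulnC mulrnA E24_4P mul0rn.
Qed.

End Points.

(** * Rank and torsion of the group *)

Theorem theorem3p2 :
  has_zrank (ec_point E24) 0 /\
  torsion_isog (ec_point E24) 'Z_4 /\
  (exists P : ec_point E24,
     ec_val P = Some (2, 8 * Qa_var + 2) /\ torsion_generated_by P).
Proof.
have tors (Q : ec_point E24) : torsion Q by exists 4%N; rewrite // E24_torsion.
split; last split.
- split.
    by exists (fun _ => 0) => c _ [].
  (* Every point is killed by 4, so the coefficient 4 on the first vector alone is a nontrivial
     relation in any nonempty family. *)
  move=> [|n] // v /(_ (fun i => if i == 0 then 4 else 0)) /= h.
  have : (4 : int) = 0; last by [].
  have <- := h _ 0; first by rewrite eqxx.
  rewrite big_ord_recl eqxx big1 ?addr0; first exact: E24_torsion.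
  by move=> i _; rewrite mulr0z.
- exists E24_multiple; split=> [|x]; first exact: E24_multiple_inj.
  by split=> // _; exact: E24_points.
- exists E24_P; split=> // x; split=> // _.
  by have [k ->] := E24_points x; exists (k : nat).
Qed.
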